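(* In the wavelength restricted setting, where each fiber is used by at most $W$ paths, let $m$ be the number of fibers. With $T=O\left(\log\frac{m}{1-q}\right)$ iterations, the randomized rounding algorithm gives an $O\left(W\log\frac{m}{1-q}\right)$ approximation to the MFSP problem with probability at least $q$.
   Context: There are $m$ fibers (links of a physical topology) and a given set of logical $s$-$t$ paths $1,\dots,n$, each with an associated set of fibers that it uses; a path survives the failure of a fiber if it does not use that fiber. Wavelength restriction: each fiber is used by at most $W$ of the given paths. A set of paths is survivable if for every fiber at least one path of the set survives the failure of that fiber. The MFSP problem is to find a survivable path set that uses the minimum number of fibers, where a fiber used by several selected paths is counted once. An $\alpha$ approximation is a survivable path set that uses at most $\alpha$ times this minimum number of fibers. Let $A=(a_{ij})\in\mathbb{R}^{m\times n}$ with $a_{ij}=0$ if path $j$ uses fiber $i$ and $a_{ij}=1$ otherwise, and let $e$ be the all-ones vector of length $m$. LP relaxation of MFSP: minimize $\sum_{i=1}^m f_i$ subject to $AP\ge e$; $f_i\ge P_j$ for every path $j$ and every fiber $i$ used by path $j$; $0\le P_j\le 1$ for all $j$. Randomized rounding algorithm: (1) Initialize $S=\emptyset$ and solve the LP relaxation; let $P_j^*$ and $f_i^*$ be the optimal values for path $j$ and fiber $i$. (2) Select each path $j$ with probability $P_j^*$ (selections being independent), and add it to $S$ if selected. (3) Repeat step 2 for $T$ times. The selected path set is $S$.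
   Formalization: The constant hidden in the O(W log(m/(1-q))) approximation factor may depend on q (the one in T may not), since a constant independent of q is false; the LP also carries the constraint f_i >= 0, which is implied for every used fiber. *)

(* Defs.v *)
From HB Require Import structures.
From mathcomp Require Import all_boot all_order all_algebra.
From mathcomp Require Import reals exp.
Set Implicit Arguments.
Unset Strict Implicit.
Unset Printing Implicit Defensive.
Import Order.TTheory GRing.Theory Num.Theory.
Local Open Scope ring_scope.

(* An instance is [F : 'I_n -> {set 'I_m}], where [F j] is the set of fibers
   used by path [j]; different paths may use the same set of fibers. *)

Definition wavelength_restricted m n (F : 'I_n -> {set 'I_m}) (W : nat) : Prop :=
  forall i : 'I_m, (#|[set j : 'I_n | i \in F j]| <= W)%N.

Definition survives m n (F : 'I_n -> {set 'I_m}) (j : 'I_n) (i : 'I_m) : bool :=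
  i \notin F j.

Definition survivable m n (F : 'I_n -> {set 'I_m}) (S : {set 'I_n}) : bool :=
  [forall i : 'I_m, exists j in S, survives F j i].

Definition fibers_used m n (F : 'I_n -> {set 'I_m}) (S : {set 'I_n}) : nat :=
  #|\bigcup_(j in S) F j|.

(* The default value [m] of the minimum is harmless: every path set uses at
   most [m] fibers, so it matters only when no path set is survivable. *)
Definition mfsp_opt m n (F : 'I_n -> {set 'I_m}) : nat :=
  \big[minn/m]_(S : {set 'I_n} | survivable F S) fibers_used F S.

Definition is_approx (R : realType) m n (F : 'I_n -> {set 'I_m}) (alpha : R)
    (S : {set 'I_n}) : bool :=
  survivable F S && ((fibers_used F S)%:R <= alpha * (mfsp_opt F)%:R).

Definition survival_mx (R : realType) m n (F : 'I_n -> {set 'I_m}) :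
    'M[R]_(m, n) :=
  \matrix_(i, j) (if i \in F j then 0 else 1).

(* The constraint [0 <= f i] follows from the others whenever fiber [i] is used
   by some path; for an unused fiber it is what keeps the program bounded. *)
Definition lp_feasible (R : realType) m n (F : 'I_n -> {set 'I_m})
    (P : 'cV[R]_n) (f : 'cV[R]_m) : Prop :=
  [/\ forall i, (const_mx 1 : 'cV[R]_m) i 0 <= (survival_mx R F *m P) i 0,
      forall j i, i \in F j -> P j 0 <= f i 0,
      forall j, 0 <= P j 0 <= 1
    & forall i, 0 <= f i 0].

Definition lp_optimal (R : realType) m n (F : 'I_n -> {set 'I_m})
    (P : 'cV[R]_n) (f : 'cV[R]_m) : Prop :=
  lp_feasible F P f /\
  forall P' f', lp_feasible F P' f' -> \sum_i f i 0 <= \sum_i f' i 0.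

(* An outcome of the rounding records, for each round [t < T] and each path
   [j], whether [j] is selected in round [t]; the [T * n] selections are
   independent and path [j] is selected with probability [P j 0]. *)
Definition outcome (T n : nat) := {ffun 'I_T * 'I_n -> bool}.

Definition outcome_prob (R : realType) T n (P : 'cV[R]_n) (w : outcome T n) : R :=
  \prod_(tj : 'I_T * 'I_n) (if w tj then P tj.2 0 else 1 - P tj.2 0).

Definition selected T n (w : outcome T n) : {set 'I_n} :=
  [set j | [exists t : 'I_T, w (t, j)]].

Definition rounding_prob (R : realType) n (P : 'cV[R]_n) (T : nat)
    (E : pred {set 'I_n}) : R :=
  \sum_(w : outcome T n | E (selected w)) outcome_prob P w.

(* For [0 < m], [0 <= q < 1] and [0 < c] the ceiling is a nonnegative integer,
   so the absolute value only changes its type. *)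
Definition iterations (R : realType) (c : R) (m : nat) (q : R) : nat :=
  `|Num.ceil (c * ln (m%:R / (1 - q)))|%N.

(* Main.v *)
Require Import Defs.
From HB Require Import structures.
From mathcomp Require Import all_boot all_order all_algebra.
From mathcomp Require Import reals exp.
From mathcomp Require Import sequences ring lra.
Set Implicit Arguments.
Unset Strict Implicit.
Unset Printing Implicit Defensive.
Import Order.TTheory GRing.Theory Num.Theory.
Local Open Scope ring_scope.

(** Two bad events can spoil the rounded set, and each gets a share of the
    allowed failure probability [1 - q].  Write [L = ln (m / (1 - q))] and run
    [T = ceil (2 L)] rounds.

    Survivability.  A fiber [i] is fatal only if none of the [T * n]
    independent selections picks a path avoiding [i].  This has probability
    [\prod (1 - P_j)], at most [expR (- \sum P_j)], and the sum is at least [T]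
    because the covering constraint of the program holds in every round
    ([fiber_failure_prob]).  By the union bound over the fibers, the set fails
    to be survivable with probability at most
    [m * expR (- T) <= m * ((1 - q) / m) ^+ 2 <= (1 - q) ^+ 2]
    ([survivability_failure_prob]).  The factor 2 in [T] is what makes this
    strictly less than [1 - q].

    Cost.  Counting a fiber once for every selection of a path through it
    overestimates the cost, and the expected overestimate is
    [T * \sum_i \sum_(j | i \in F j) P_j <= T * W * \sum_i f_i], since a fiber
    carries at most [W] paths and each of them has [P_j <= f_i]
    ([expected_fibers_used]).  The program is a relaxation, so
    [\sum_i f_i] is at most the optimum ([lp_le_mfsp_opt]).  Markov's inequality
    then bounds the probability of exceeding [C * W * L] times the optimum by
    [T / (C * L)].

    The remaining budget is [(1 - q) - (1 - q) ^+ 2 = q * (1 - q)], and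
    [T / L <= 2 + 1 / L <= 2 + 1 / (- ln (1 - q))] for [q > 0], so
    [C = (2 + 1 / (- ln (1 - q))) / (q * (1 - q))] suffices; for [q = 0] there
    is nothing to prove. *)

(** * Finite nonnegative measures *)

Lemma union_bound (R : numDomainType) (X I : finType) (mu : X -> R)
    (E : I -> pred X) :
  (forall x, 0 <= mu x) ->
  \sum_(x | [exists i, E i x]) mu x <= \sum_i \sum_(x | E i x) mu x.
Proof.
move=> mu0; under [leRHS]eq_bigr do rewrite big_mkcond.
rewrite exchange_big big_mkcond; apply: ler_sum => x _.
have ge0 i : 0 <= (if E i x then mu x else 0) by case: ifP.
case: ifPn => [/existsP[i Ei]|_]; last exact: sumr_ge0.
by rewrite (bigD1 i) //= Ei lerDl sumr_ge0.
Qed.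

(** The bound on the mean is written as a product, [d * b], so that the case
    [b = 0] is covered too: there the mean vanishes, and a nonzero integer is at
    least 1. *)
Lemma markov_nat (R : realFieldType) (X : finType) (mu : X -> R) (N : X -> nat)
    (d b : R) :
  (forall x, 0 <= mu x) -> 0 <= d -> 0 <= b ->
  \sum_x mu x * (N x)%:R <= d * b ->
  \sum_(x | b < (N x)%:R) mu x <= d.
Proof.
move=> mu0 d0; rewrite le_eqVlt => /predU1P[<-|b0] mean.
- apply: le_trans d0; rewrite mulr0 in mean; apply: le_trans mean.
  rewrite big_mkcond; apply: ler_sum => x _.
  by case: ifPn => [|_]; rewrite ?mulr_ge0 // ltr0n => N0; rewrite ler_peMr ?ler1n.
- rewrite -(ler_pM2r b0) mulr_suml; apply: le_trans mean.
  rewrite big_mkcond; apply: ler_sum => x _.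
  by case: ifPn => [/ltW|_]; rewrite ?mulr_ge0 // => /ler_wpM2l; apply.
Qed.

(** * Independent selections *)

Section Rounding.
Variables (R : realType) (m n T : nat).
Implicit Types (F : 'I_n -> {set 'I_m}) (P : 'cV[R]_n) (f : 'cV[R]_m).

Lemma outcome_prob_ge0 P (w : outcome T n) :
  (forall j, 0 <= P j 0 <= 1) -> 0 <= outcome_prob P w.
Proof.
move=> P01; apply: prodr_ge0 => x _.
by have /andP[P0 P1] := P01 x.2; case: ifP; rewrite ?subr_ge0.
Qed.

(** Distributing the product over the sums turns a constraint on each separate
    selection into a product; this is the independence of the selections. *)
Lemma cylinder_prob P (B : 'I_T * 'I_n -> pred bool) :
  \sum_(w : outcome T n | [forall x, B x (w x)]) outcome_prob P w =
  \prod_x ((if B x true then P x.2 0 else 0) +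
           (if B x false then 1 - P x.2 0 else 0)).
Proof.
transitivity (\prod_(x : 'I_T * 'I_n) \sum_(b | B x b)
  (if b then P x.2 0 else 1 - P x.2 0)).
  by rewrite bigA_distr_big_dep; apply: eq_bigl.
by apply: eq_bigr => x _; rewrite big_mkcond big_bool.
Qed.

Lemma outcome_prob_total P : \sum_(w : outcome T n) outcome_prob P w = 1.
Proof.
apply: etrans (etrans (cylinder_prob P (fun _ _ => true)) _).
  by apply: eq_bigl => w; apply/esym/forallP.
by rewrite big1 // => x _; rewrite addrC subrK.
Qed.

Lemma selection_prob P (x : 'I_T * 'I_n) :
  \sum_(w : outcome T n | w x) outcome_prob P w = P x.2 0.
Proof.
apply: etrans (etrans (cylinder_prob P (fun y b => (y == x) ==> b)) _).
  apply: eq_bigl => w; apply/idP/forallP => [wx y|/(_ x)]; last by rewrite eqxx.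
  by apply/implyP => /eqP ->.
rewrite (bigD1 x) //= eqxx /= addr0 big1 ?mulr1 // => y /negPf -> /=.
by rewrite addrC subrK.
Qed.

(** * Survivability of the rounded set *)

Lemma fiber_failure_prob F P f (i : 'I_m) : lp_feasible F P f ->
  \sum_(w : outcome T n | [forall x, (i \notin F x.2) ==> ~~ w x])
    outcome_prob P w <= expR (- T%:R).
Proof.
case=> cover _ P01 _.
rewrite (cylinder_prob P (fun x b => (i \notin F x.2) ==> ~~ b)).
pose a (x : 'I_T * 'I_n) : R := survival_mx R F i x.2 * P x.2 0.
apply: (@le_trans _ _ (\prod_x expR (- a x))).
  apply: ler_prod => x _; rewrite /a mxE; have /andP[P0 P1] := P01 x.2.
  case: (i \in F x.2) => /=; last by rewrite add0r mul1r subr_ge0 P1 expR_ge1Dx.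
  by rewrite mul0r oppr0 expR0 [_ + _]addrC subrK ler01 lexx.
rewrite -expR_sum ler_expR sumrN lerN2.
rewrite -(pair_bigA _ (fun _ j => survival_mx R F i j * P j 0)) /=.
have := cover i; rewrite !mxE => cover_i.
by rewrite sumr_const card_ord -[leLHS]mulr1 -[leRHS]mulr_natl ler_wpM2l.
Qed.

Lemma not_survivable_failure F (w : outcome T n) :
  ~~ survivable F (selected w) ->
  [exists i, forall x, (i \notin F x.2) ==> ~~ w x].
Proof.
case/forallPn => i /existsPn noj; apply/existsP; exists i.
apply/forallP => -[t j] /=; apply/implyP => iFj; apply/negP => wtj.
have /negP := noj j; apply; rewrite /survives iFj andbT inE.
by apply/existsP; exists t.
Qed.

Lemma survivability_failure_prob F P f : lp_feasible F P f ->
  \sum_(w : outcome T n | ~~ survivable F (selected w)) outcome_prob P w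
    <= m%:R * expR (- T%:R).
Proof.
move=> feas; have [_ _ P01 _] := feas.
have mu0 w := outcome_prob_ge0 w P01.
apply: (@le_trans _ _ (\sum_(i < m) expR (- T%:R))); last first.
  by rewrite sumr_const card_ord -[leLHS]mulr_natl.
apply: (@le_trans _ _ (\sum_(i < m)
  \sum_(w : outcome T n | [forall x, (i \notin F x.2) ==> ~~ w x])
    outcome_prob P w)); last by apply: ler_sum => i _; exact: fiber_failure_prob feas.
apply: (le_trans _ (union_bound _ mu0)).
rewrite big_mkcond [leRHS]big_mkcond; apply: ler_sum => w _.
by case: ifPn => [/not_survivable_failure -> //|_]; case: ifP.
Qed.

(** * Cost of the rounded set *)

Lemma fibers_used_le F (w : outcome T n) :
  (fibers_used F (selected w) <= \sum_(x | w x) #|F x.2|)%N.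
Proof.
apply: (@leq_trans (\sum_(j in selected w) #|F j|)%N).
  rewrite /fibers_used; elim/big_rec2: _ => [|j s A _ IH]; first by rewrite cards0.
  by rewrite (leq_trans (leq_card_setU _ _)) ?leq_add2l.
rewrite [leqLHS]big_mkcond [leqRHS]big_mkcond /=.
have -> : (\sum_(x : 'I_T * 'I_n) (if w x then #|F x.2| else 0) =
    \sum_t \sum_j (if w (t, j) then #|F j| else 0))%N.
  by rewrite pair_bigA; apply: eq_bigr => -[].
rewrite exchange_big leq_sum // => j _; case: ifP => //.
by rewrite inE => /existsP[t wtj]; rewrite (bigD1 t) //= wtj leq_addr.
Qed.

(** A selection of path [j] contributes [#|F j|] to the overestimate; summing
    over fibers instead of paths brings in the wavelength bound. *)
Lemma lp_path_cost F P f (W : nat) : wavelength_restricted F W ->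
  lp_feasible F P f ->
  \sum_j P j 0 * #|F j|%:R <= W%:R * \sum_i f i 0.
Proof.
move=> Wr [_ Pf _ f0].
have -> : \sum_j P j 0 * #|F j|%:R = \sum_i \sum_(j | i \in F j) P j 0.
  rewrite (exchange_big_dep predT) //=; apply: eq_bigr => j _.
  by rewrite sumr_const mulr_natr.
rewrite mulr_sumr; apply: ler_sum => i _.
apply: (@le_trans _ _ (\sum_(j | i \in F j) f i 0)).
  by apply: ler_sum => j; exact: Pf.
rewrite sumr_const -[leLHS]mulr_natl ler_wpM2r // ler_nat.
by have := Wr i; rewrite cardsE.
Qed.

Lemma expected_fibers_used F P f (W : nat) : wavelength_restricted F W ->
  lp_feasible F P f ->
  \sum_(w : outcome T n) outcome_prob P w * (fibers_used F (selected w))%:R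
    <= T%:R * (W%:R * \sum_i f i 0).
Proof.
move=> Wr feas; have [_ _ P01 _] := feas.
apply: (@le_trans _ _ (\sum_(w : outcome T n)
  \sum_x if w x then outcome_prob P w * #|F x.2|%:R else 0)).
  apply: ler_sum => w _; rewrite -big_mkcond -mulr_sumr -natr_sum.
  by rewrite ler_wpM2l ?outcome_prob_ge0 // ler_nat fibers_used_le.
rewrite exchange_big /=.
under eq_bigr do rewrite -big_mkcond -mulr_suml selection_prob.
rewrite -(pair_bigA _ (fun _ j => P j 0 * #|F j|%:R)) /=.
rewrite sumr_const card_ord -[leLHS]mulr_natl ler_wpM2l //.
exact: lp_path_cost.
Qed.

End Rounding.

(** * The linear program as a relaxation *)

(** This is what makes the program a relaxation: integral solutions are the
    indicator vectors of survivable sets and of the fibers they use, at the same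
    cost. *)
Lemma survivable_lp_feasible (R : realType) m n (F : 'I_n -> {set 'I_m})
    (S : {set 'I_n}) : survivable F S ->
  lp_feasible F (\col_j (j \in S)%:R : 'cV[R]_n)
    (\col_i (i \in \bigcup_(j in S) F j)%:R).
Proof.
move=> /forallP surv; split=> [i|j i iFj|j|i]; rewrite !mxE ?ler0n ?lern1 ?leq_b1 //.
- have /existsP[j /andP[jS sj]] := surv i.
  rewrite (bigD1 j) //= !mxE (negPf sj) jS mulr1 lerDl sumr_ge0 // => k _.
  by rewrite !mxE mulr_ge0 // ?ler0n; case: ifP.
- rewrite ler_nat; case: (boolP (j \in S)) => // jS.
  by rewrite (_ : _ \in _) //; apply/bigcupP; exists j.
Qed.

Lemma lp_le_fibers_used (R : realType) m n (F : 'I_n -> {set 'I_m})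
    (P : 'cV[R]_n) (f : 'cV[R]_m) (S : {set 'I_n}) :
  lp_optimal F P f -> survivable F S -> \sum_i f i 0 <= (fibers_used F S)%:R.
Proof.
move=> [_ opt] /(survivable_lp_feasible R) /opt /le_trans; apply.
rewrite (eq_bigr (fun i => (i \in \bigcup_(j in S) F j)%:R)) => [|i _]; last first.
  by rewrite mxE.
by rewrite -natr_sum ler_nat -big_mkcond /= sum1_card.
Qed.

(** A fiber used by every path would make its row of the matrix vanish, which
    contradicts the covering constraint. *)
Lemma lp_feasible_survivable (R : realType) m n (F : 'I_n -> {set 'I_m})
    (P : 'cV[R]_n) (f : 'cV[R]_m) :
  lp_feasible F P f -> survivable F [set: 'I_n].
Proof.
case=> cover _ _ _; apply/forallP => i; apply/contraT => /existsPn noj.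
have := cover i; rewrite !mxE big1 ?ler10 // => j _.
by rewrite mxE; have := noj j; rewrite in_setT /survives negbK => ->; rewrite mul0r.
Qed.

(** The default value [m] of the minimum needs a survivable set to compare
    with, since it is not itself the cost of one. *)
Lemma lp_le_mfsp_opt (R : realType) m n (F : 'I_n -> {set 'I_m})
    (P : 'cV[R]_n) (f : 'cV[R]_m) :
  lp_optimal F P f -> \sum_i f i 0 <= (mfsp_opt F)%:R.
Proof.
move=> opt; apply: (big_ind (fun k : nat => \sum_i f i 0 <= k%:R)) => [|a b pa pb|S];
  last 2 first.
- by rewrite /minn; case: (a < b)%N.
- exact: lp_le_fibers_used opt.
apply: le_trans (lp_le_fibers_used opt (lp_feasible_survivable opt.1)) _.
by rewrite ler_nat -[leqRHS]card_ord max_card.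
Qed.

(** * The approximation guarantee *)

(** Union bound over the two ways to fail, where [delta] is the probability that
    Markov's inequality leaves for the cost.  Choosing [T] and [alpha] is then a
    matter of arithmetic. *)
Lemma rounding_prob_ge (R : realType) m n (F : 'I_n -> {set 'I_m}) (W T : nat)
    (P : 'cV[R]_n) (f : 'cV[R]_m) (alpha delta : R) :
  wavelength_restricted F W -> lp_optimal F P f ->
  0 <= delta -> 0 <= alpha -> T%:R * W%:R <= delta * alpha ->
  1 - (m%:R * expR (- T%:R) + delta) <= rounding_prob P T (is_approx F alpha).
Proof.
move=> Wr opt d0 a0 Tda; have [feas _] := opt; have [_ _ P01 _] := feas.
have mu0 (w : outcome T n) := outcome_prob_ge0 w P01.
have cost : \sum_(w : outcome T n |
    alpha * (mfsp_opt F)%:R < (fibers_used F (selected w))%:R)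
    outcome_prob P w <= delta.
  apply: markov_nat => //; first by rewrite mulr_ge0.
  apply: le_trans (expected_fibers_used T Wr feas) _.
  rewrite !mulrA; apply: (@le_trans _ _ (T%:R * W%:R * (mfsp_opt F)%:R)).
    by rewrite ler_wpM2l ?mulr_ge0 // (lp_le_mfsp_opt opt).
  by rewrite ler_wpM2r.
rewrite lerBlDr -[leLHS](outcome_prob_total T P).
apply: (le_trans _ (lerD (lexx _) (lerD (survivability_failure_prob T feas) cost))).
rewrite /rounding_prob [X in _ <= X + _]big_mkcond.
rewrite [X in _ <= _ + (X + _)]big_mkcond [X in _ <= _ + (_ + X)]big_mkcond.
rewrite -!big_split; apply: ler_sum => w _ /=.
rewrite /is_approx ltNge; have := mu0 w.
by case: (survivable _ _); case: (_ <= alpha * _) => /=; lra.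
Qed.

Lemma iterations_bounds (R : realType) (c q : R) (m : nat) :
  0 <= c * ln (m%:R / (1 - q)) ->
  c * ln (m%:R / (1 - q)) <= (iterations c m q)%:R
    <= c * ln (m%:R / (1 - q)) + 1.
Proof.
rewrite /iterations; set x := c * _ => x0.
have c0 : 0 <= Num.ceil x by rewrite ceil_ge0 (lt_le_trans _ x0) ?ltrN10.
have -> : `|Num.ceil x|%N%:R = (Num.ceil x)%:~R :> R.
  by rewrite -[in RHS](gez0_abs c0).
have /andP[lt_x ->] := real_ceil_itv (num_real x).
by rewrite -lerBlDr -[1](mulr1z 1) -intrB ltW.
Qed.

Theorem theorem8 (R : realType) :
  exists2 c : R, 0 < c &
  forall q : R, 0 <= q < 1 ->
  exists2 C : R, 0 < C &
  forall (m n W : nat) (F : 'I_n -> {set 'I_m}) (P : 'cV[R]_n) (f : 'cV[R]_m),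
    (0 < m)%N ->
    wavelength_restricted F W ->
    lp_optimal F P f ->
    q <= rounding_prob P (iterations c m q)
           (is_approx F (C * W%:R * ln (m%:R / (1 - q)))).
Proof.
exists 2 => // q /andP[]; rewrite le_eqVlt => /predU1P[<- _|q0 q1].
  exists 1 => // m n W F P f _ _ [[_ _ P01 _] _].
  by apply: sumr_ge0 => w _; exact: outcome_prob_ge0.
have q1' : 0 < 1 - q by rewrite subr_gt0.
(* [L0] is the value of [ln (m / (1 - q))] at [m = 1], its smallest value. *)
pose L0 : R := - ln (1 - q).
have L00 : 0 < L0 by rewrite oppr_gt0 ln_lt0 // q1' /= gtrBl.
have d0 : 0 < q * (1 - q) by rewrite mulr_gt0.
have K0 : 0 < 2 + L0^-1 by rewrite addr_gt0 ?invr_gt0.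
exists ((2 + L0^-1) / (q * (1 - q))); first by rewrite divr_gt0.
move=> m n W F P f m0 Wr opt; set L := ln _.
have m1 : 1 <= m%:R :> R by rewrite ler1n.
have m0' : 0 < m%:R :> R by rewrite ltr0n.
have LL0 : L0 <= L by rewrite /L ln_div ?posrE // /L0; have := ln_ge0 m1; lra.
have L_gt0 : 0 < L by apply: lt_le_trans LL0.
have /andP[T_ge T_le] : 2 * L <= (iterations 2 m q)%:R <= 2 * L + 1.
  by apply: iterations_bounds; rewrite mulr_ge0 // ltW.
set T := iterations _ _ _ in T_ge T_le *.
apply: le_trans (rounding_prob_ge (T := T) (delta := q * (1 - q)) Wr opt _ _ _).
- have mT : m%:R * expR (- T%:R) <= (1 - q) ^+ 2.
    apply: (@le_trans _ _ (m%:R * ((1 - q) / m%:R) ^+ 2)).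
      rewrite ler_wpM2l //.
      have -> : (1 - q) / m%:R = expR (- L).
        by rewrite expRN lnK ?invf_div // posrE divr_gt0.
      by rewrite -expRM_natl ler_expR mulrN lerN2.
    have -> : m%:R * ((1 - q) / m%:R) ^+ 2 = (1 - q) ^+ 2 / m%:R.
      by field; rewrite gt_eqF.
    by rewrite ler_pdivrMr // ler_peMr // sqr_ge0.
  by move: mT; rewrite expr2; lra.
- exact: ltW.
- by rewrite !mulr_ge0 ?invr_ge0 // ltW.
- have TL : T%:R <= (2 + L0^-1) * L.
    apply: le_trans T_le _; rewrite [leRHS]mulrDl lerD2l.
    by rewrite mulrC ler_pdivlMr ?mul1r.
  have -> : q * (1 - q) * ((2 + L0^-1) / (q * (1 - q)) * W%:R * L) =
      (2 + L0^-1) * L * W%:R.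
    by field; rewrite !gt_eqF.
  by rewrite ler_wpM2r.
Qed.
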